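(* Let $H$ be a finite-dimensional factorizable ribbon Hopf algebra over an algebraically closed field $k$ of characteristic zero and $\omega$ a Hopf algebra automorphism of $H$. The $H$-bimodule $F_\omega$ together with the dinatural family of morphisms $$\imath^{F_\omega}_X:=(\omega^{-1})^*\circ\imath^F_X,\qquad \imath^F_X\colon X^*\otimes_k X\to H^*,\quad \imath^F_X(\xi\otimes x)(h)=\xi(h.x),$$ is the coend of the functor $G^{H;\omega}_{\otimes_k}\colon H\text{-Mod}^{\mathrm{op}}\times H\text{-Mod}\to H\text{-Bimod}$.
   Context: $H$ has antipode $S$, coproduct written $\Delta(h)=h_{(1)}\otimes h_{(2)}$; $H\text{-Mod}$ and $H\text{-Bimod}$ are the categories of finite-dimensional left $H$-modules and of finite-dimensional $H$-bimodules. Quasitriangular: endowed with an invertible $R\in H\otimes H$ with $\Delta^{\mathrm{op}}(h)=R\,\Delta(h)R^{-1}$, $(\Delta\otimes\mathrm{id})(R)=R_{13}R_{23}$, $(\mathrm{id}\otimes\Delta)(R)=R_{13}R_{12}$. Ribbon: moreover a central invertible $v$ with $S(v)=v$, $\varepsilon(v)=1$, $\Delta(v)=(v\otimes v)Q^{-1}$, where $Q=R_{21}R$. Factorizable: $Q=\sum_\ell h_\ell\otimes k_\ell$ with $\{h_\ell\}$, $\{k_\ell\}$ bases of $H$. A Hopf algebra automorphism is an algebra and coalgebra automorphism commuting with $S$. $F_\omega$ is the vector space $H^*$ with actions $(h.p)(x)=p(S(h)x)$ and $(p.h)(x)=p(x\,S^{-1}(\omega(h)))$. The functor $G^{H;\omega}_{\otimes_k}$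 acts on morphisms as $f\times g\mapsto f^*\otimes_k g$ ($f^*$ the transpose), and on objects it sends $X\times Y$ to $X^*\otimes_k Y$ with actions $h.(\xi\otimes y)=\xi\big(S(\omega^{-1}(h)).\,-\big)\otimes y$ and $(\xi\otimes y).h=\xi\otimes S^{-1}(h).y$. A dinatural transformation from a functor $G\colon\mathcal C^{\mathrm{op}}\times\mathcal C\to\mathcal D$ to $B\in\mathcal D$ is a family of morphisms $\varphi_X\colon G(X,X)\to B$ with $\varphi_Y\circ G(\mathrm{id}_Y,f)=\varphi_X\circ G(f,\mathrm{id}_X)$ for all $f\colon X\to Y$. A coend of $G$ is an initial such pair $(A,\iota)$: for every dinatural transformation $(B,\varphi)$ there is a unique morphism $\kappa\colon A\to B$ with $\kappa\circ\iota_X=\varphi_X$ for all $X$. Here $(\omega^{-1})^*\colon H^*\to H^*$, $p\mapsto p\circ\omega^{-1}$. *)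

(* Defs.v *)
From HB Require Import structures.
From mathcomp Require Import all_boot all_algebra all_field.
From mathcomp Require Import ring boolp.

Set Implicit Arguments.
Unset Strict Implicit.
Unset Printing Implicit Defensive.

Import GRing.Theory.
Local Open Scope ring_scope.

Import VectorInternalTheory.

(* The tensor product is realised by coordinate matrices; [tens_ind] and
   [tens_liftE] express its universal property. *)
Definition tens (k : fieldType) (V W : vectType k) : Type :=
  'M[k]_(dim V, dim W).
HB.instance Definition _ (k : fieldType) (V W : vectType k) :=
  Vector.copy (tens V W) 'M[k]_(dim V, dim W).

Definition tensor (k : fieldType) (V W : vectType k) (v : V) (w : W) :
  tens V W := (v2r v)^T *m v2r w.

Notation "v ⊗ w" := (tensor v w) (at level 40, left associativity) : ring_scope.

Definition bilin (k : fieldType) (V W U : vectType k) (f : V -> W -> U) :=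
  (forall v : V, linear (f v)) /\ (forall w : W, linear (f^~ w)).

Definition tens_lift_fun (k : fieldType) (V W U : vectType k)
    (f : V -> W -> U) (t : tens V W) : U :=
  \sum_i \sum_j (t : 'M_(_, _)) i j *:
     f (r2v (delta_mx 0 i)) (r2v (delta_mx 0 j)).

(* The linear map with [v ⊗ w |-> f v w], for [f] bilinear ([tens_liftE]). *)
Definition tens_lift (k : fieldType) (V W U : vectType k) (f : V -> W -> U) :
    'Hom(tens V W, U) := linfun (tens_lift_fun f).

Section TensTheory.
Variables (k : fieldType) (V W U : vectType k).
Implicit Types (v : V) (w : W) (t : tens V W).

Lemma tensor_bilin : bilin (@tensor k V W).
Proof.
split=> [v a x y|w a x y]; rewrite /tensor.
  by rewrite linearP mulmxDr -scalemxAr.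
by rewrite !linearP mulmxDl -scalemxAl.
Qed.

Lemma tens_lift_linear (f : V -> W -> U) : linear (tens_lift_fun f).
Proof.
move=> a x y; rewrite /tens_lift_fun scaler_sumr -big_split.
apply: eq_bigr => i _ /=.
rewrite scaler_sumr -big_split; apply: eq_bigr => j _ /=.
by rewrite !mxE scalerDl scalerA.
Qed.
HB.instance Definition _ f := GRing.isLinear.Build k (tens V W) U _ _
  (tens_lift_linear f).

Lemma r2v_sum (X : vectType k) (x : X) :
  x = \sum_i v2r x 0 i *: r2v (delta_mx 0 i).
Proof.
rewrite -{1}[x]v2rK {1}[v2r x]row_sum_delta linear_sum.
by apply: eq_bigr => i _; rewrite linearZ.
Qed.

Lemma bilin_suml (f : V -> W -> U) I (r : seq I) P F w : bilin f ->
  f (\sum_(i <- r | P i) F i) w = \sum_(i <- r | P i) f (F i) w.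
Proof.
case=> _ /(_ w) fl; pose g : {linear V -> U} := HB.pack (f^~ w)
  (GRing.isLinear.Build _ _ _ _ _ fl).
exact: (raddf_sum g).
Qed.

Lemma bilin_sumr (f : V -> W -> U) I (r : seq I) P F v : bilin f ->
  f v (\sum_(i <- r | P i) F i) = \sum_(i <- r | P i) f v (F i).
Proof.
case=> /(_ v) fl _; pose g : {linear W -> U} := HB.pack (f v)
  (GRing.isLinear.Build _ _ _ _ _ fl).
exact: (raddf_sum g).
Qed.

Lemma bilinZ (f : V -> W -> U) a b v w : bilin f ->
  f (a *: v) (b *: w) = (a * b) *: f v w.
Proof.
case=> fr fl; rewrite -scalerA.
pose g : {linear W -> U} := HB.pack (f v) (GRing.isLinear.Build _ _ _ _ _ (fr v)).
pose h : {linear V -> U} := HB.pack (f^~ (b *: w))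
  (GRing.isLinear.Build _ _ _ _ _ (fl (b *: w))).
have <- : f v (b *: w) = b *: f v w := linearZZ g b w.
exact: (linearZZ h a v).
Qed.

Lemma tens_liftE (f : V -> W -> U) : bilin f ->
  forall v w, tens_lift f (v ⊗ w) = f v w.
Proof.
move=> fb v w; rewrite lfunE /= /tens_lift_fun /tensor.
rewrite [in RHS](r2v_sum v) bilin_suml //; apply: eq_bigr => i _.
rewrite [in RHS](r2v_sum w) bilin_sumr //; apply: eq_bigr => j _.
by rewrite bilinZ // !mxE big_ord1 !mxE.
Qed.

Lemma tens_sum t : exists s : seq (V * W), t = \sum_(p <- s) p.1 ⊗ p.2.
Proof.
exists [seq (r2v ((t : 'M_(_, _)) i j *: delta_mx 0 i),
             r2v (delta_mx 0 j)) | i <- enum 'I_(dim V), j <- enum 'I_(dim W)].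
rewrite big_allpairs_dep big_enum /= {1}[t]matrix_sum_delta.
apply: eq_bigr => i _; rewrite big_enum; apply: eq_bigr => j _ /=.
rewrite /tensor !r2vK linearZ /= trmx_delta -scalemxAl.
by rewrite mul_delta_mx.
Qed.

Lemma tens_ind (P : tens V W -> Prop) :
  (forall v w, P (v ⊗ w)) -> (forall x y, P x -> P y -> P (x + y)) ->
  forall t, P t.
Proof.
move=> Pt PD t; have [s ->] := tens_sum t.
elim: s => [|p s IH]; last by rewrite big_cons; apply: PD.
have := Pt 0 0; rewrite big_nil /tensor.
by have -> : v2r (0 : W) = 0 := linear0 _; rewrite mulmx0.
Qed.

Lemma tens_liftD (f : V -> W -> U) t t' :
  tens_lift f (t + t') = tens_lift f t + tens_lift f t'.
Proof. exact: linearD. Qed.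

Lemma tens_ext (f g : 'Hom(tens V W, U)) :
  (forall v w, f (v ⊗ w) = g (v ⊗ w)) -> f = g.
Proof.
move=> fg; apply/lfunP; elim/tens_ind=> [//|x y fx fy].
by rewrite [LHS]linearD [RHS]linearD /= fx fy.
Qed.
End TensTheory.

Section TensAlgebra.
Variables (k : fieldType) (A B : falgType k).
Implicit Types (x y z : tens A B).

(* The multiplication with [(a ⊗ b) (a' ⊗ b') = a a' ⊗ b b'] ([tensM]). *)
Definition tens_mul (x y : tens A B) : tens A B :=
  tens_lift (fun a b =>
    tens_lift (fun a' b' => (a * a') ⊗ (b * b') : tens A B) y) x.

Fact tens_mul_bilin1 a b :
  bilin (fun a' b' => (a * a') ⊗ (b * b') : tens A B).
Proof.
have [tl tr] := @tensor_bilin k A B.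
split=> [u c v w|u c v w] /=.
  by rewrite mulrDr -scalerAr tl.
by rewrite mulrDr -scalerAr tr.
Qed.

Fact tens_mul_bilin2 y : bilin (fun a b =>
  tens_lift (fun a' b' => (a * a') ⊗ (b * b') : tens A B) y).
Proof.
have [tl tr] := @tensor_bilin k A B.
split=> [a|b] c u v /=; elim/tens_ind: y => [a' b'|x y IHx IHy].
- by rewrite !tens_liftE ?mulrDl -?scalerAl ?tl //; apply: tens_mul_bilin1.
- by rewrite !tens_liftD IHx IHy scalerDr addrACA.
- by rewrite !tens_liftE ?mulrDl -?scalerAl ?tr //; apply: tens_mul_bilin1.
- by rewrite !tens_liftD IHx IHy scalerDr addrACA.
Qed.

Fact tens_mulE a b a' b' :
  tens_mul (a ⊗ b) (a' ⊗ b') = (a * a') ⊗ (b * b').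
Proof.
rewrite /tens_mul (tens_liftE (tens_mul_bilin2 _)) tens_liftE //.
exact: tens_mul_bilin1.
Qed.

Fact tens_mulDl : left_distributive tens_mul +%R.
Proof. by move=> x y z; rewrite /tens_mul linearD. Qed.

Fact tens_mulZl c x y : tens_mul (c *: x) y = c *: tens_mul x y.
Proof. by rewrite /tens_mul linearZ. Qed.

Fact tens_mulPr c x y z :
  tens_mul x (c *: y + z) = c *: tens_mul x y + tens_mul x z.
Proof.
elim/tens_ind: x => [a b|x x' IHx IHx'].
  by rewrite /tens_mul !(tens_liftE (tens_mul_bilin2 _)) linearP.
by rewrite !tens_mulDl IHx IHx' scalerDr addrACA.
Qed.

Fact tens_mulDr : right_distributive tens_mul +%R.
Proof. by move=> x y z; rewrite -[y]scale1r tens_mulPr !scale1r. Qed.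

Fact tens_mulZr c x y : tens_mul x (c *: y) = c *: tens_mul x y.
Proof.
have x0 : tens_mul x 0 = 0.
  by have := tens_mulPr (-1) x 0 0; rewrite scaler0 addr0 scaleN1r addNr.
by rewrite -[c *: y]addr0 tens_mulPr x0 addr0.
Qed.

Fact tens_mulA : associative tens_mul.
Proof.
move=> x y z.
elim/tens_ind: x => [a b|x x' IHx IHx']; last by rewrite !tens_mulDl IHx IHx'.
elim/tens_ind: y => [a' b'|y y' IHy IHy'];
  last by rewrite tens_mulDl !tens_mulDr tens_mulDl IHy IHy'.
elim/tens_ind: z => [a'' b''|z z' IHz IHz'];
  last by rewrite !tens_mulDr IHz IHz'.
by rewrite !tens_mulE !mulrA.
Qed.

Fact tens_mul1 : left_id (1 ⊗ 1) tens_mul.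
Proof.
elim/tens_ind=> [a b|x y IHx IHy]; last by rewrite tens_mulDr IHx IHy.
by rewrite tens_mulE !mul1r.
Qed.

Fact tens_mulr1 : right_id (1 ⊗ 1) tens_mul.
Proof.
elim/tens_ind=> [a b|x y IHx IHy]; last by rewrite tens_mulDl IHx IHy.
by rewrite tens_mulE !mulr1.
Qed.

Fact v2r1_neq0 (C : falgType k) : v2r (1 : C) != 0.
Proof.
apply/eqP => v1; apply: (elimN eqP (oner_neq0 C)); apply: v2r_inj.
by rewrite v1; apply: esym (linear0 _).
Qed.

Fact tens_1neq0 : (1 ⊗ 1 : tens A B) != 0.
Proof.
apply/eqP => /matrixP t0.
have [i ai] : exists i, v2r (1 : A) 0 i != 0.
  exact/rV0Pn/v2r1_neq0.
have [j bj] : exists i, v2r (1 : B) 0 i != 0.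
  exact/rV0Pn/v2r1_neq0.
have := t0 i j; rewrite !mxE big_ord1 !mxE => /eqP.
by rewrite mulf_eq0 (negPf ai) (negPf bj).
Qed.

HB.instance Definition _ := GRing.Zmodule_isNzRing.Build (tens A B)
  tens_mulA tens_mul1 tens_mulr1 tens_mulDl tens_mulDr tens_1neq0.

Fact tens_scaleAl (c : k) (x y : tens A B) : c *: (x * y) = (c *: x) * y.
Proof. by rewrite [RHS]tens_mulZl. Qed.

HB.instance Definition _ := GRing.Lmodule_isLalgebra.Build k (tens A B)
  tens_scaleAl.

Fact tens_scaleAr (c : k) (x y : tens A B) : c *: (x * y) = x * (c *: y).
Proof. by rewrite [RHS]tens_mulZr. Qed.

HB.instance Definition _ := GRing.Lalgebra_isAlgebra.Build k (tens A B)
  tens_scaleAr.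
HB.instance Definition _ := Algebra_isFalgebra.Build k (tens A B).

Lemma tensM (a a' : A) (b b' : B) :
  (a ⊗ b) * (a' ⊗ b') = (a * a') ⊗ (b * b') :> tens A B.
Proof. exact: tens_mulE. Qed.

Lemma tens1 : 1 ⊗ 1 = 1 :> tens A B.
Proof. by []. Qed.

End TensAlgebra.

Section TensMaps.
Variable k : fieldType.

Definition tens_map (V V' W W' : vectType k) (f : 'Hom(V, V'))
    (g : 'Hom(W, W')) : 'Hom(tens V W, tens V' W') :=
  tens_lift (fun v w => f v ⊗ g w).

Definition tens_swap (V W : vectType k) : 'Hom(tens V W, tens W V) :=
  tens_lift (fun v w => w ⊗ v).

Definition tens_assoc (U V W : vectType k) :
    'Hom(tens U (tens V W), tens (tens U V) W) :=
  tens_lift (fun u t => tens_lift (fun v w => (u ⊗ v) ⊗ w) t).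

Local Notation dual V := 'Hom(V, k^o).

Definition dual_map (V W : vectType k) (f : 'Hom(V, W)) :
    'Hom(dual W, dual V) := linfun (fun xi : dual W => (xi \o f)%VF : dual V).

End TensMaps.

(* Finite dimension is part of [falgType]. *)
Record hopfAlgebra (k : fieldType) := HopfAlgebra {
  hopf_alg :> falgType k;
  coprod : 'AHom(hopf_alg, tens hopf_alg hopf_alg);
  counit : 'AHom(hopf_alg, k^o);
  antipode : 'End(hopf_alg);
  coprodA : forall h : hopf_alg,
    tens_assoc hopf_alg hopf_alg hopf_alg (tens_map \1 coprod (coprod h)) =
    tens_map coprod \1 (coprod h);
  counitl : forall h : hopf_alg,
    tens_lift (fun a b : hopf_alg => counit a *: b) (coprod h) = h;
  counitr : forall h : hopf_alg,
    tens_lift (fun a b : hopf_alg => counit b *: a) (coprod h) = h;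
  antipodel : forall h : hopf_alg,
    tens_lift (fun a b : hopf_alg => antipode a * b) (coprod h) =
    counit h *: 1;
  antipoder : forall h : hopf_alg,
    tens_lift (fun a b : hopf_alg => a * antipode b) (coprod h) =
    counit h *: 1
}.

Arguments coprod {k _}.
Arguments counit {k _}.
Arguments antipode {k _}.

Section Legs.
Variables (k : fieldType) (H : hopfAlgebra k) (t : tens H H).

Definition leg12 : tens (tens H H) H := t ⊗ 1.
Definition leg13 : tens (tens H H) H :=
  tens_lift (fun a b : H => (a ⊗ (1 : H)) ⊗ b) t.
Definition leg23 : tens (tens H H) H :=
  tens_lift (fun a b : H => ((1 : H) ⊗ a) ⊗ b) t.

End Legs.

Record qtHopfAlgebra (k : fieldType) := QtHopfAlgebra {
  qt_hopf :> hopfAlgebra k;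
  Rmx : tens qt_hopf qt_hopf;
  Rmx_unit : Rmx \is a GRing.unit;
  Rmx_coprod : forall h : qt_hopf,
    tens_swap qt_hopf qt_hopf (coprod h) = Rmx * coprod h * Rmx^-1;
  Rmx_coprodl : tens_map coprod \1 Rmx = leg13 Rmx * leg23 Rmx;
  Rmx_coprodr :
    tens_assoc qt_hopf qt_hopf qt_hopf (tens_map \1 coprod Rmx) =
    leg13 Rmx * leg12 Rmx
}.

Arguments Rmx {k _}.

Definition Qmx (k : fieldType) (H : qtHopfAlgebra k) : tens H H :=
  tens_swap H H Rmx * Rmx.

Definition factorizable (k : fieldType) (H : qtHopfAlgebra k) : Prop :=
  exists hs ks : (\dim {:H}).-tuple H,
    [/\ basis_of {:H} hs, basis_of {:H} ks &
        Qmx H = \sum_(i < \dim {:H}) tnth hs i ⊗ tnth ks i].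

Record ribbonHopfAlgebra (k : fieldType) := RibbonHopfAlgebra {
  ribbon_qt :> qtHopfAlgebra k;
  ribbon_elt : ribbon_qt;
  ribbon_central : forall h : ribbon_qt, ribbon_elt * h = h * ribbon_elt;
  ribbon_unit : ribbon_elt \is a GRing.unit;
  ribbon_antipode : antipode ribbon_elt = ribbon_elt;
  ribbon_counit : counit ribbon_elt = 1;
  ribbon_coprod :
    coprod ribbon_elt = (ribbon_elt ⊗ ribbon_elt) * (Qmx ribbon_qt)^-1
}.

Record hopfAut (k : fieldType) (H : hopfAlgebra k) := HopfAut {
  aut_ahom :> 'AEnd(H);
  aut_bij : bijective aut_ahom;
  aut_coprod : forall h : H,
    coprod (aut_ahom h) = tens_map aut_ahom aut_ahom (coprod h);
  aut_counit : forall h : H, counit (aut_ahom h) = counit h;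
  aut_antipode : forall h : H, antipode (aut_ahom h) = aut_ahom (antipode h)
}.

(* The statement involves [S^-1], for which the library's linear inverse
   [(antipode^-1)%VF] is used.  It is the inverse because the antipode of a
   quasitriangular Hopf algebra is bijective ([antipodeK], [antipodeVK]). *)

Definition tens_seq (k : fieldType) (V W : vectType k) (t : tens V W) :
  seq (V * W) := sval (cid (tens_sum t)).

Section TensSeq.
Variables (k : fieldType) (V W U : vectType k).

Lemma tens_seqE (t : tens V W) : t = \sum_(p <- tens_seq t) p.1 ⊗ p.2.
Proof. by rewrite /tens_seq; case: cid. Qed.

Lemma tens_lift_seq (f : V -> W -> U) (t : tens V W) : bilin f ->
  tens_lift f t = \sum_(p <- tens_seq t) f p.1 p.2.
Proof.
move=> fb; rewrite {1}[t]tens_seqE linear_sum.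
by apply: eq_bigr => p _; apply: tens_liftE.
Qed.

Lemma tensorDl (v v' : V) (w : W) : (v + v') ⊗ w = v ⊗ w + v' ⊗ w.
Proof.
by have [_ /(_ w 1 v v')] := tensor_bilin V W; rewrite !scale1r.
Qed.
Lemma tensorDr (v : V) (w w' : W) : v ⊗ (w + w') = v ⊗ w + v ⊗ w'.
Proof.
by have [/(_ v 1 w w') + _] := tensor_bilin V W; rewrite !scale1r.
Qed.
Lemma tensorZl c (v : V) (w : W) : (c *: v) ⊗ w = c *: (v ⊗ w).
Proof. by have := bilinZ c 1 v w (tensor_bilin V W); rewrite scale1r mulr1. Qed.
Lemma tensorZr c (v : V) (w : W) : v ⊗ (c *: w) = c *: (v ⊗ w).
Proof. by have := bilinZ 1 c v w (tensor_bilin V W); rewrite scale1r mul1r. Qed.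
End TensSeq.

Ltac bilinexp := by split=> [? ? ? ?|? ? ? ?];
   rewrite /= ?linearP /= ?(mulrDl, mulrDr, tensorDl, tensorDr, tensorZl, tensorZr)
   -?(scalerAl, scalerAr) ?(tensorZl, tensorZr).

Section HopfTheory.
Variables (k : fieldType) (H : hopfAlgebra k).
Local Notation S := (@antipode k H).
Local Notation sw h := (tens_seq (coprod h)).

Lemma tens_map_bilin (V V' W W' : vectType k) (f : 'Hom(V, V')) (g : 'Hom(W, W')) :
  bilin (fun v w => f v ⊗ g w).
Proof. bilinexp. Qed.

Lemma tens_mapE (V V' W W' : vectType k) (f : 'Hom(V, V')) (g : 'Hom(W, W')) v w :
  tens_map f g (v ⊗ w) = f v ⊗ g w.
Proof. by apply: tens_liftE; apply: tens_map_bilin. Qed.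

Lemma swl (h : H) : \sum_(p <- sw h) S p.1 * p.2 = counit h *: 1.
Proof. rewrite -antipodel tens_lift_seq //. bilinexp. Qed.
Lemma swr (h : H) : \sum_(p <- sw h) p.1 * S p.2 = counit h *: 1.
Proof. rewrite -antipoder tens_lift_seq //. bilinexp. Qed.
Lemma swel (h : H) : \sum_(p <- sw h) counit p.1 *: p.2 = h.
Proof. rewrite -[RHS]counitl tens_lift_seq //.
split=> [? ? ? ?|? ? ? ?] /=.
  by rewrite scalerDr !scalerA mulrC.
by rewrite linearP /= scalerDl scalerA.
Qed.
Lemma swer (h : H) : \sum_(p <- sw h) counit p.2 *: p.1 = h.
Proof. rewrite -[RHS]counitr tens_lift_seq //.
split=> [? ? ? ?|? ? ? ?] /=.
  by rewrite linearP /= scalerDl scalerA.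
by rewrite scalerDr !scalerA mulrC.
Qed.

Definition trilin (X Y Z U : vectType k) (f : X -> Y -> Z -> U) :=
  (forall c, bilin (fun a b => f a b c)) /\ (forall a b, linear (f a b)).

Section Lift3.
Variables (X Y Z U : vectType k) (f : X -> Y -> Z -> U) (ft : trilin f).

Definition lift3 : 'Hom(tens (tens X Y) Z, U) :=
  tens_lift (fun t c => tens_lift (fun a b => f a b c) t).

Lemma lift3_bilin :
  bilin (fun (t : tens X Y) c => tens_lift (fun a b => f a b c) t).
Proof.
case: ft => fb fl; split=> [t|c] a x y /=; last by rewrite linearP.
elim/tens_ind: t => [u v|t t' IH IH']; first by rewrite !tens_liftE // fl.
by rewrite !tens_liftD IH IH' scalerDr addrACA.
Qed.

Lemma lift3E a b c : lift3 ((a ⊗ b) ⊗ c) = f a b c.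
Proof.
by rewrite /lift3 (tens_liftE lift3_bilin) tens_liftE //; case: ft.
Qed.
End Lift3.

Lemma tens_assocE (X Y Z : vectType k) (a : X) (b : Y) (c : Z) :
  tens_assoc X Y Z (a ⊗ (b ⊗ c)) = (a ⊗ b) ⊗ c.
Proof.
have bi (u : X) : bilin (fun (v : Y) (w : Z) => (u ⊗ v) ⊗ w) by bilinexp.
rewrite tens_liftE; first by rewrite tens_liftE.
split=> [u|t] d x y /=; first by rewrite linearP.
elim/tens_ind: t => [u v|t t' IH IH']; last first.
  by rewrite !tens_liftD IH IH' scalerDr addrACA.
by rewrite !tens_liftE // !tensorDl !tensorZl.
Qed.

Lemma swA (U : vectType k) (f : H -> H -> H -> U) h : trilin f ->
  \sum_(p <- sw h) \sum_(q <- sw p.1) f q.1 q.2 p.2 =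
  \sum_(p <- sw h) \sum_(q <- sw p.2) f p.1 q.1 q.2.
Proof.
move=> ft; transitivity (lift3 f (tens_map coprod \1 (coprod h))).
  rewrite {2}[coprod h]tens_seqE !linear_sum /=; apply: eq_bigr => p _.
  rewrite tens_mapE id_lfunE {2}[coprod p.1]tens_seqE.
  rewrite (bilin_suml _ _ _ _ (tensor_bilin _ _)) linear_sum /=.
  by apply: eq_bigr => q _; rewrite lift3E.
rewrite -coprodA {1}[coprod h]tens_seqE !linear_sum /=; apply: eq_bigr => p _.
rewrite tens_mapE id_lfunE {1}[coprod p.2]tens_seqE.
rewrite (bilin_sumr _ _ _ _ (tensor_bilin _ _)) !linear_sum /=.
by apply: eq_bigr => q _; rewrite tens_assocE lift3E.
Qed.

Lemma antipode1 : S 1 = 1.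
Proof.
have := antipodel (1 : H); rewrite [coprod 1]rmorph1 [counit 1]rmorph1 -tens1.
by rewrite tens_liftE ?mulr1 ?scale1r //; bilinexp.
Qed.

Lemma swlM (x y : H) : \sum_(p <- sw x) \sum_(r <- sw y)
  S (p.1 * r.1) * (p.2 * r.2) = (counit x * counit y) *: 1.
Proof.
rewrite -[_ * counit y](rmorphM counit) -antipodel rmorphM /=.
rewrite {2}[coprod x]tens_seqE {2}[coprod y]tens_seqE.
rewrite mulr_suml linear_sum /=; apply: eq_bigr => p _.
rewrite mulr_sumr linear_sum /=; apply: eq_bigr => r _.
by rewrite tensM tens_liftE //; bilinexp.
Qed.

Lemma antipodeM (x y : H) : S (x * y) = S y * S x.
Proof.
pose F a b c a' b' c' := S (a * a') * (b * b') * (S c' * S c).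
have Fl a b c : trilin (F a b c).
  by split=> [c'|a' b']; [split=> [a'|b']|] => d u v;
    rewrite /F ?mulrDr -?scalerAr ?linearP /= ?mulrDr -?scalerAr ?mulrDl
            -?scalerAl ?mulrDl -?scalerAl ?mulrDr -?scalerAr.
have Fr a' b' c' : trilin (fun a b c => F a b c a' b' c').
  by split=> [c|a b]; [split=> [a|b]|] => d u v;
    rewrite /F ?mulrDl -?scalerAl ?linearP /= ?mulrDr -?scalerAr ?mulrDl
            -?scalerAl ?mulrDl -?scalerAl ?mulrDr -?scalerAr.
pose L := \sum_(p <- sw x) \sum_(q <- sw p.1)
  \sum_(r <- sw y) \sum_(s <- sw r.1) F q.1 q.2 p.2 s.1 s.2 r.2.
transitivity L; last first.
  transitivity (\sum_(p <- sw x) \sum_(r <- sw y)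
      (counit p.1 * counit r.1) *: (S r.2 * S p.2)); last first.
    rewrite -[in RHS](swel x) -[in RHS](swel y) !linear_sum /= mulr_sumr.
    apply: eq_bigr => p _; rewrite mulr_suml; apply: eq_bigr => r _.
    by rewrite !linearZ /= -scalerAl -scalerAr scalerA mulrC.
  apply: eq_bigr => p _; rewrite exchange_big /=; apply: eq_bigr => r _.
  rewrite -[S r.2 * _]mul1r scalerAl -swlM mulr_suml.
  by apply: eq_bigr => q _; rewrite mulr_suml.
have sumlin (f : H -> H -> H -> H -> H -> H -> H) y' :
    (forall a' b' c', trilin (fun a b c => f a b c a' b' c')) ->
    trilin (fun a b c => \sum_(r <- sw y') \sum_(s <- sw r.1)
      f a b c s.1 s.2 r.2).
  by move=> ft; split=> [c|a b]; [split=> [a|b]|] => d u v /=;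
    rewrite scaler_sumr -big_split; apply: eq_bigr => r _;
    rewrite /= scaler_sumr -big_split; apply: eq_bigr => s _;
    have [fb fl] := ft s.1 s.2 r.2; rewrite ?fl //; have [fb1 fb2] := fb c;
    rewrite ?fb1 ?fb2.
rewrite /L (swA _ (sumlin F y Fr)).
transitivity (\sum_(p <- sw x) \sum_(r <- sw y)
   (counit p.2 * counit r.2) *: S (p.1 * r.1)).
  rewrite -[in LHS](swer x) -[in LHS](swer y) mulr_suml linear_sum /=.
  apply: eq_bigr => p _; rewrite mulr_sumr linear_sum; apply: eq_bigr => r _.
  by rewrite -scalerAl -scalerAr scalerA linearZ.
apply: eq_bigr => p _.
under [RHS]eq_bigr do rewrite (swA _ (Fl _ _ _)).
rewrite exchange_big /=; apply: eq_bigr => r _.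
transitivity (S (p.1 * r.1) * (\sum_(q <- sw p.2) q.1 *
   (\sum_(s <- sw r.2) s.1 * S s.2) * S q.2)).
  rewrite swr; under eq_bigr do rewrite -scalerAr mulr1 -scalerAl.
  by rewrite -scaler_sumr swr scalerA -scalerAr mulr1 mulrC.
rewrite mulr_sumr; apply: eq_bigr => q _.
rewrite mulr_sumr mulr_suml mulr_sumr; apply: eq_bigr => s _.
by rewrite /F !mulrA.
Qed.
End HopfTheory.

Fact eq_sides (T : Type) (a b c d : T) : a = c -> b = d -> a = b -> c = d.
Proof. by move=> <- <-. Qed.

Section QtTheory.
Variables (k : fieldType) (H : qtHopfAlgebra k).
Local Notation S := (@antipode k H).
Local Notation sw h := (tens_seq (coprod h)).
Local Notation R := (@Rmx k H).
Local Notation sR := (tens_seq R).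

Lemma tens_map_seq (V V' W W' : vectType k) (f : 'Hom(V, V'))
    (g : 'Hom(W, W')) (t : tens V W) :
  tens_map f g t = \sum_(p <- tens_seq t) f p.1 ⊗ g p.2.
Proof. by rewrite /tens_map tens_lift_seq //; apply: tens_map_bilin. Qed.

Lemma lift3_coprodl (U : vectType k) (f : H -> H -> H -> U) : trilin f ->
  \sum_(p <- sR) \sum_(q <- sw p.1) f q.1 q.2 p.2 =
  \sum_(p <- sR) \sum_(r <- sR) f p.1 r.1 (p.2 * r.2).
Proof.
move=> ft; have := congr1 (lift3 f) (Rmx_coprodl H).
rewrite tens_map_seq !linear_sum /leg13 /leg23 /=.
rewrite tens_lift_seq; last by bilinexp.
rewrite tens_lift_seq; last by bilinexp.
apply: eq_sides.
- apply: eq_bigr => p _; rewrite id_lfunE {1}[coprod p.1]tens_seqE.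
  rewrite (bilin_suml _ _ _ _ (tensor_bilin _ _)) linear_sum /=.
  by apply: eq_bigr => q _; rewrite lift3E.
rewrite mulr_suml linear_sum /=; apply: eq_bigr => p _.
rewrite mulr_sumr linear_sum /=; apply: eq_bigr => r _.
by rewrite !tensM mulr1 mul1r lift3E.
Qed.

Lemma lift3_coprodr (U : vectType k) (f : H -> H -> H -> U) : trilin f ->
  \sum_(p <- sR) \sum_(q <- sw p.2) f p.1 q.1 q.2 =
  \sum_(p <- sR) \sum_(r <- sR) f (p.1 * r.1) r.2 p.2.
Proof.
move=> ft; have := congr1 (lift3 f) (Rmx_coprodr H).
rewrite tens_map_seq !linear_sum /leg13 /leg12 /=.
rewrite tens_lift_seq; last by bilinexp.
apply: eq_sides.
- apply: eq_bigr => p _; rewrite id_lfunE {1}[coprod p.2]tens_seqE.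
  rewrite (bilin_sumr _ _ _ _ (tensor_bilin _ _)) !linear_sum /=.
  by apply: eq_bigr => q _; rewrite tens_assocE lift3E.
rewrite mulr_suml linear_sum /=; apply: eq_bigr => p _.
rewrite {1}[R]tens_seqE (bilin_suml _ _ _ _ (tensor_bilin _ _)).
rewrite mulr_sumr linear_sum /=; apply: eq_bigr => r _.
by rewrite !tensM mulr1 mul1r lift3E.
Qed.

Lemma counitP c (a b : H) : counit (c *: a + b) = c * counit a + counit b.
Proof. exact: linearP. Qed.

Ltac trilinexp := split=> [?|? ?]; [split=> [?|?]|] => ? ? ?;
  rewrite /= ?linearP ?counitP /= ?(mulrDl, mulrDr, tensorDl, tensorDr) -?(scalerAl, scalerAr)
    ?(tensorDl, tensorDr, tensorZl, tensorZr) ?(scalerDl, scalerDr, scalerA) //;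
  do ?congr (_ + _); try done; by congr (_ *: _); ring.

Ltac bilinexp2 := split=> [?|?] => ? ? ?;
  rewrite /= ?counitP ?scalerDl ?scalerDr ?scalerA //;
  do ?congr (_ + _); try done; by congr (_ *: _); ring.

Lemma Rmx_counitl : \sum_(p <- sR) counit p.1 *: p.2 = 1.
Proof.
pose f (a b c : H) := counit a *: (b ⊗ c).
have ft : trilin f by rewrite /f; trilinexp.
have := lift3_coprodl ft; rewrite /f.
have -> : \sum_(p <- sR) \sum_(q <- sw p.1) counit q.1 *: (q.2 ⊗ p.2) = R.
  rewrite [RHS]tens_seqE; apply: eq_bigr => p _.
  rewrite -[in RHS](swel p.1) (bilin_suml _ _ _ _ (tensor_bilin _ _)).
  by apply: eq_bigr => q _; rewrite tensorZl.
have -> : \sum_(p <- sR) \sum_(r <- sR) counit p.1 *: (r.1 ⊗ (p.2 * r.2)) =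
  (1 ⊗ (\sum_(p <- sR) counit p.1 *: p.2)) * R.
  rewrite (bilin_sumr _ _ _ _ (tensor_bilin _ _)) mulr_suml.
  apply: eq_bigr => p _; rewrite {2}[R]tens_seqE mulr_sumr.
  by apply: eq_bigr => r _; rewrite tensorZr -scalerAl tensM mul1r.
move=> e1; have /(mulIr (Rmx_unit H)) : 1 * R =
  (1 ⊗ (\sum_(p <- sR) counit p.1 *: p.2)) * R by rewrite mul1r.
move/(congr1 (tens_lift (fun a b : H => counit a *: b))).
by rewrite -tens1 !tens_liftE ?[counit 1]rmorph1 ?scale1r //; bilinexp2.
Qed.

Lemma Rmx_counitr : \sum_(p <- sR) counit p.2 *: p.1 = 1.
Proof.
pose f (a b c : H) := counit c *: (a ⊗ b).
have ft : trilin f by rewrite /f; trilinexp.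
have := lift3_coprodr ft; rewrite /f.
have -> : \sum_(p <- sR) \sum_(q <- sw p.2) counit q.2 *: (p.1 ⊗ q.1) = R.
  rewrite [RHS]tens_seqE; apply: eq_bigr => p _.
  rewrite -[in RHS](swer p.2) (bilin_sumr _ _ _ _ (tensor_bilin _ _)).
  by apply: eq_bigr => q _; rewrite tensorZr.
have -> : \sum_(p <- sR) \sum_(r <- sR) counit p.2 *: ((p.1 * r.1) ⊗ r.2) =
  ((\sum_(p <- sR) counit p.2 *: p.1) ⊗ 1) * R.
  rewrite (bilin_suml _ _ _ _ (tensor_bilin _ _)) mulr_suml.
  apply: eq_bigr => p _; rewrite {2}[R]tens_seqE mulr_sumr.
  by apply: eq_bigr => r _; rewrite tensorZl -scalerAl tensM mul1r.
move=> e1; have /(mulIr (Rmx_unit H)) : 1 * R =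
  ((\sum_(p <- sR) counit p.2 *: p.1) ⊗ 1) * R by rewrite mul1r.
move/(congr1 (tens_lift (fun a b : H => counit b *: a))).
by rewrite -tens1 !tens_liftE ?[counit 1]rmorph1 ?scale1r //; bilinexp2.
Qed.

Lemma Rmx_antipodel : tens_map S \1 R * R = 1.
Proof.
pose f (a b c : H) := (S a * b) ⊗ c.
have ft : trilin f by rewrite /f; trilinexp.
have /esym := lift3_coprodl ft; rewrite /f; apply: eq_sides; last first.
  rewrite -[RHS]tens1 -[X in _ = _ ⊗ X]Rmx_counitl.
  rewrite (bilin_sumr _ _ _ _ (tensor_bilin _ _)); apply: eq_bigr => p _.
  rewrite tensorZr -tensorZl -swl (bilin_suml _ _ _ _ (tensor_bilin _ _)).
  by [].
apply: esym; rewrite tens_map_seq mulr_suml; apply: eq_bigr => p _.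
rewrite {1}[R]tens_seqE mulr_sumr; apply: eq_bigr => r _.
by rewrite tensM id_lfunE.
Qed.

Lemma Rmx_antipode : tens_map S S R = R.
Proof.
have RV : tens_map S \1 R = R^-1.
  by rewrite -[LHS](mulrK (Rmx_unit H)) Rmx_antipodel mul1r.
suff ZY : tens_map S S R * tens_map S \1 R = 1.
  by rewrite -[LHS](mulrVK (Rmx_unit H)) -RV ZY mul1r.
pose f (a b c : H) := S a ⊗ (S b * c).
have ft : trilin f by rewrite /f; trilinexp.
have := lift3_coprodr ft; rewrite /f => e.
transitivity (\sum_(p <- sR) \sum_(r <- sR) S (p.1 * r.1) ⊗ (S r.2 * p.2)).
  rewrite exchange_big /= tens_map_seq mulr_suml; apply: eq_bigr => r _.
  rewrite tens_map_seq mulr_sumr; apply: eq_bigr => p _.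
  by rewrite tensM id_lfunE antipodeM.
rewrite -e -[RHS]tens1 -[X in _ = X ⊗ _]antipode1 -[X in S X]Rmx_counitr.
rewrite linear_sum (bilin_suml _ _ _ _ (tensor_bilin _ _)).
apply: eq_bigr => p _.
rewrite linearZ /= tensorZl -tensorZr -swl.
by rewrite (bilin_sumr _ _ _ _ (tensor_bilin _ _)).
Qed.

Lemma Rmx_antipode2 :
  \sum_(p <- sR) \sum_(r <- sR) (p.1 * S (S r.1)) ⊗ (p.2 * S r.2) = 1.
Proof.
have RV : tens_map S \1 R = R^-1.
  by rewrite -[LHS](mulrK (Rmx_unit H)) Rmx_antipodel mul1r.
rewrite -(mulrV (Rmx_unit H)) -RV -[X in tens_map S \1 X]Rmx_antipode.
rewrite {3}[R]tens_seqE mulr_suml; apply: eq_bigr => p _.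
rewrite [tens_map S S R]tens_map_seq linear_sum mulr_sumr; apply: eq_bigr => r _ /=.
by rewrite tens_mapE id_lfunE tensM.
Qed.

(* Drinfeld's element [u = S(R_2) R_1] implements the square of [S]. *)
Lemma antipode2_conj (h : H) :
  S (S h) * (\sum_(p <- sR) S p.2 * p.1) =
  (\sum_(p <- sR) S p.2 * p.1) * h.
Proof.
set u := \sum_(p <- sR) S p.2 * p.1.
have G (x : H) : counit x *: u =
    \sum_(q <- sw x) \sum_(p <- sR) S (p.2 * q.2) * (p.1 * q.1).
  have := congr1 (fun t => t * R) (Rmx_coprod x).
  rewrite (mulrVK (Rmx_unit H)).
  move/(congr1 (tens_lift (fun a b : H => S b * a))).
  have bi : bilin (fun a b : H => S b * a) by bilinexp.
  apply: eq_sides.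
    rewrite [tens_swap _ _ _]tens_lift_seq; last by bilinexp.
    rewrite {1}[R]tens_seqE mulr_sumr linear_sum /= /u scaler_sumr.
    apply: eq_bigr => p _; rewrite mulr_suml linear_sum /=.
    transitivity (S p.2 * (\sum_(q <- sw x) S q.1 * q.2) * p.1).
      rewrite mulr_sumr mulr_suml; apply: eq_bigr => q _.
      by rewrite tensM tens_liftE // antipodeM !mulrA.
    by rewrite swl -scalerAr mulr1 -scalerAl.
  rewrite exchange_big {1}[R]tens_seqE mulr_suml linear_sum /=.
  apply: eq_bigr => p _; rewrite {1}[coprod x]tens_seqE mulr_sumr linear_sum /=.
  by apply: eq_bigr => q _; rewrite tensM tens_liftE.
rewrite -[in LHS](swel h) !linear_sum /= mulr_suml.
transitivity (\sum_(a <- sw h) \sum_(q <- sw a.1)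
    S (q.2 * S a.2) * u * q.1).
  apply: eq_bigr => a _; rewrite !linearZ /= -scalerAl scalerAr G mulr_sumr.
  apply: eq_bigr => q _; rewrite /u mulr_sumr mulr_suml mulr_sumr.
  by apply: eq_bigr => p _; rewrite !antipodeM !mulrA.
pose f a b c := S (b * S c) * u * a.
have ft : trilin f.
  split=> [c|a b]; [split=> [a|b]|] => d x y; rewrite /f /=.
  - by rewrite mulrDl -scalerAl linearP mulrDl -scalerAl mulrDl -scalerAl.
  - by rewrite mulrDr -scalerAr.
  - by rewrite linearP mulrDr -scalerAr linearP mulrDl -scalerAl mulrDl -scalerAl.
rewrite (swA h ft) /f -[in RHS](swer h) mulr_sumr; apply: eq_bigr => a _.
rewrite -!mulr_suml -linear_sum swr linearZ /= antipode1.
by rewrite -!scalerAl mul1r scalerAr.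
Qed.

Lemma antipode_inj : injective S.
Proof.
pose u := \sum_(p <- sR) S p.2 * p.1.
pose w := \sum_(r <- sR) r.2 * S (S r.1).
have uw : u * w = 1.
  have bi : bilin (fun a b : H => S b * a) by bilinexp.
  have := congr1 (tens_lift (fun a b : H => S b * a)) Rmx_antipode2.
  rewrite -tens1 tens_liftE // antipode1 mulr1 => <-.
  rewrite linear_sum /w mulr_sumr /=.
  under [RHS]eq_bigr do rewrite linear_sum.
  rewrite [RHS]exchange_big; apply: eq_bigr => r _ /=.
  rewrite mulrA -antipode2_conj mulr_sumr mulr_suml; apply: eq_bigr => p _.
  by rewrite tens_liftE // antipodeM !mulrA.
have kw : lker (amull w) == 0%VS.
  apply/lker0P => x y; rewrite !lfunE /= => exy.
  by rewrite -[x]mul1r -[y]mul1r -uw -!mulrA exy.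
have wu : w * u = 1.
  have [z wz] : exists z, w * z = 1.
    by exists ((amull w)^-1%VF 1); have := lker0_lfunVK kw 1; rewrite lfunE.
  by rewrite -[u]mulr1 -wz [u * _]mulrA uw mul1r.
move=> x y eS; rewrite -[x]mul1r -[y]mul1r -wu -!mulrA.
by rewrite -!antipode2_conj eS.
Qed.

Lemma antipode_lker0 : lker S == 0%VS.
Proof. exact/lker0P/antipode_inj. Qed.

Lemma antipodeK : cancel S (S^-1)%VF.
Proof. exact/lker0_lfunK/antipode_lker0. Qed.

Lemma antipodeVK : cancel (S^-1)%VF S.
Proof. exact/lker0_lfunVK/antipode_lker0. Qed.

Lemma antipodeV1 : (S^-1)%VF 1 = 1.
Proof. by rewrite -{1}antipode1 antipodeK. Qed.

Lemma antipodeVM (x y : H) :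
  (S^-1)%VF (x * y) = (S^-1)%VF y * (S^-1)%VF x.
Proof. by apply: antipode_inj; rewrite antipodeM !antipodeVK. Qed.

End QtTheory.

Section AutTheory.
Variables (k : fieldType) (H : hopfAlgebra k) (om : hopfAut H).

Lemma aut_lker0 : lker om == 0%VS.
Proof. by apply/lker0P; apply: bij_inj (aut_bij om). Qed.

Lemma autK : cancel om (om^-1)%VF.
Proof. exact/lker0_lfunK/aut_lker0. Qed.

Lemma autVK : cancel (om^-1)%VF om.
Proof. exact/lker0_lfunVK/aut_lker0. Qed.

Lemma aut1 : om 1 = 1.
Proof. exact: rmorph1. Qed.

Lemma autM (x y : H) : om (x * y) = om x * om y.
Proof. exact: rmorphM. Qed.

Lemma autV1 : (om^-1)%VF 1 = 1.
Proof. by rewrite -{1}aut1 autK. Qed.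

Lemma autVM (x y : H) : (om^-1)%VF (x * y) = (om^-1)%VF x * (om^-1)%VF y.
Proof. by apply: (bij_inj (aut_bij om)); rewrite autM !autVK. Qed.

End AutTheory.

Record category := Category {
  cat_obj :> Type;
  mor : cat_obj -> cat_obj -> Type;
  idm : forall X, mor X X;
  compm : forall X Y Z, mor Y Z -> mor X Y -> mor X Z;
  comp1m : forall X Y (f : mor X Y), compm (idm Y) f = f;
  compm1 : forall X Y (f : mor X Y), compm f (idm X) = f;
  compA : forall X Y Z T (f : mor Z T) (g : mor Y Z) (h : mor X Y),
    compm f (compm g h) = compm (compm f g) h
}.

Arguments mor {c} _ _.
Arguments idm {c} X.
Arguments compm {c X Y Z} _ _.

Definition opp_cat (C : category) : category :=
  @Category C (fun X Y => @mor C Y X) (fun X => idm X)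
    (fun X Y Z f g => compm g f)
    (fun X Y f => compm1 f) (fun X Y f => comp1m f)
    (fun X Y Z T f g h => esym (compA h g f)).

Section ProdCat.
Variables C D : category.
Implicit Types X Y Z : C * D.

Let phom X Y : Type := mor X.1 Y.1 * mor X.2 Y.2.
Let pid X : phom X X := (idm X.1, idm X.2).
Let pcomp X Y Z (f : phom Y Z) (g : phom X Y) : phom X Z :=
  (compm f.1 g.1, compm f.2 g.2).

Fact prod_comp1m X Y (f : phom X Y) : pcomp (pid Y) f = f.
Proof. by case: f => f g; rewrite /pcomp !comp1m. Qed.
Fact prod_compm1 X Y (f : phom X Y) : pcomp f (pid X) = f.
Proof. by case: f => f g; rewrite /pcomp !compm1. Qed.
Fact prod_compA X Y Z (T : C * D) (f : phom Z T) (g : phom Y Z)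
  (h : phom X Y) : pcomp f (pcomp g h) = pcomp (pcomp f g) h.
Proof. by rewrite /pcomp !compA. Qed.

Definition prod_cat : category :=
  Category prod_comp1m prod_compm1 prod_compA.

End ProdCat.

Record functor (C D : category) := Functor {
  fobj :> C -> D;
  fmap : forall X Y : C, mor X Y -> mor (fobj X) (fobj Y);
  fmap1 : forall X, fmap (idm X) = idm (fobj X);
  fmapM : forall X Y Z (f : mor Y Z) (g : mor X Y),
    fmap (compm f g) = compm (fmap f) (fmap g)
}.

Arguments fmap {C D} _ {X Y} _.

Section Coend.
Variables (C D : category) (G : functor (prod_cat (opp_cat C) C) D).

(* [G(f, g)] for [f : X' -> X] and [g : Y -> Y']. *)
Definition bimap (X X' Y Y' : C) (f : mor X' X) (g : mor Y Y') :
    mor (G (X, Y)) (G (X', Y')) :=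
  @fmap _ _ G (X, Y) (X', Y') (f, g).

Definition dinatural (B : D) (phi : forall X : C, mor (G (X, X)) B) : Prop :=
  forall (X Y : C) (f : mor X Y),
    compm (phi Y) (bimap (idm Y) f) = compm (phi X) (bimap f (idm X)).

Definition is_coend (A : D) (iota : forall X : C, mor (G (X, X)) A) : Prop :=
  dinatural iota /\
  forall (B : D) (phi : forall X : C, mor (G (X, X)) B), dinatural phi ->
    exists! kappa : mor A B, forall X, compm kappa (iota X) = phi X.

End Coend.

(* Finite-dimensional left modules; [mact h x] is [h.x]. *)
Record module (k : fieldType) (H : falgType k) := Module {
  module_sort :> vectType k;
  mact : 'Hom(H, 'End(module_sort));
  mact1 : mact 1 = \1%VF;
  mactM : forall a b : H, mact (a * b) = (mact a \o mact b)%VF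
}.

Arguments mact {k H _}.

Record module_hom (k : fieldType) (H : falgType k) (X Y : module H) :=
  ModuleHom {
    module_lfun :> 'Hom(X, Y);
    module_homP : forall (h : H) (x : X),
      module_lfun (mact h x) = mact h (module_lfun x)
  }.

(* Finite-dimensional bimodules; [lact h x] is [h.x] and [ract h x] is [x.h]. *)
Record bimodule (k : fieldType) (H : falgType k) := Bimodule {
  bimodule_sort :> vectType k;
  lact : 'Hom(H, 'End(bimodule_sort));
  ract : 'Hom(H, 'End(bimodule_sort));
  lact1 : lact 1 = \1%VF;
  lactM : forall a b : H, lact (a * b) = (lact a \o lact b)%VF;
  ract1 : ract 1 = \1%VF;
  ractM : forall a b : H, ract (a * b) = (ract b \o ract a)%VF;
  lactract : forall a b : H, (lact a \o ract b)%VF = (ract b \o lact a)%VF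
}.

Arguments lact {k H _}.
Arguments ract {k H _}.

Record bimodule_hom (k : fieldType) (H : falgType k) (X Y : bimodule H) :=
  BimoduleHom {
    bimodule_lfun :> 'Hom(X, Y);
    bimodule_homl : forall (h : H) (x : X),
      bimodule_lfun (lact h x) = lact h (bimodule_lfun x);
    bimodule_homr : forall (h : H) (x : X),
      bimodule_lfun (ract h x) = ract h (bimodule_lfun x)
  }.

Local Obligation Tactic := idtac.

Section ModuleCategories.
Variables (k : fieldType) (H : falgType k).

Lemma module_hom_eq (X Y : module H) (f g : module_hom X Y) :
  module_lfun f = module_lfun g -> f = g.
Proof.
by case: f g => [f fP] [g gP] /= e; subst g; congr ModuleHom;
   apply: Prop_irrelevance.
Qed.

Lemma bimodule_hom_eq (X Y : bimodule H) (f g : bimodule_hom X Y) :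
  bimodule_lfun f = bimodule_lfun g -> f = g.
Proof.
by case: f g => [f fl fr] [g gl gr] /= e; subst g; congr BimoduleHom;
   apply: Prop_irrelevance.
Qed.

Program Definition module_id (X : module H) : module_hom X X :=
  @ModuleHom k H X X \1%VF _.
Next Obligation. by move=> X h x; rewrite !id_lfunE. Qed.

Program Definition module_comp (X Y Z : module H) (f : module_hom Y Z)
    (g : module_hom X Y) : module_hom X Z :=
  @ModuleHom k H X Z (f \o g)%VF _.
Next Obligation. by move=> X Y Z f g h x; rewrite !comp_lfunE !module_homP. Qed.

Program Definition Mod : category :=
  @Category (module H) (@module_hom k H) module_id module_comp _ _ _.
Next Obligation.
by move=> X Y f; apply: module_hom_eq; rewrite /= comp_lfun1l.
Qed.
Next Obligation.
by move=> X Y f; apply: module_hom_eq; rewrite /= comp_lfun1r.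
Qed.
Next Obligation.
by move=> X Y Z T f g h; apply: module_hom_eq; rewrite /= comp_lfunA.
Qed.

Program Definition bimodule_id (X : bimodule H) : bimodule_hom X X :=
  @BimoduleHom k H X X \1%VF _ _.
Next Obligation. by move=> X h x; rewrite !id_lfunE. Qed.
Next Obligation. by move=> X h x; rewrite !id_lfunE. Qed.

Program Definition bimodule_comp (X Y Z : bimodule H) (f : bimodule_hom Y Z)
    (g : bimodule_hom X Y) : bimodule_hom X Z :=
  @BimoduleHom k H X Z (f \o g)%VF _ _.
Next Obligation.
by move=> X Y Z f g h x; rewrite !comp_lfunE !bimodule_homl.
Qed.
Next Obligation.
by move=> X Y Z f g h x; rewrite !comp_lfunE !bimodule_homr.
Qed.

Program Definition Bimod : category :=
  @Category (bimodule H) (@bimodule_hom k H) bimodule_id bimodule_comp _ _ _.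
Next Obligation.
by move=> X Y f; apply: bimodule_hom_eq; rewrite /= comp_lfun1l.
Qed.
Next Obligation.
by move=> X Y f; apply: bimodule_hom_eq; rewrite /= comp_lfun1r.
Qed.
Next Obligation.
by move=> X Y Z T f g h; apply: bimodule_hom_eq; rewrite /= comp_lfunA.
Qed.

End ModuleCategories.

Section LinearTheory.
Variable k : fieldType.
Local Notation dual V := 'Hom(V, k^o).

Lemma linfunE (V W : vectType k) (f : V -> W) : linear f -> linfun f =1 f.
Proof.
move=> fl; pose g : {linear V -> W} := HB.pack f
  (GRing.isLinear.Build _ _ _ _ _ fl).
exact: (lfunE g).
Qed.

Lemma dual_mapE (V W : vectType k) (f : 'Hom(V, W)) (xi : dual W) (v : V) :
  dual_map f xi v = xi (f v).
Proof.
rewrite /dual_map linfunE ?comp_lfunE // => a x y; apply/lfunP => u.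
by rewrite comp_lfunE !add_lfunE !scale_lfunE !comp_lfunE.
Qed.

Lemma dual_map_linear (V W : vectType k) : linear (@dual_map k V W).
Proof.
move=> a f g; apply/lfunP => xi; apply/lfunP => v.
by rewrite dual_mapE !lfun_simp !dual_mapE linearP.
Qed.

Lemma dual_map1 (V : vectType k) : dual_map \1%VF = \1%VF :> 'End(dual V).
Proof.
by apply/lfunP => xi; apply/lfunP => v; rewrite dual_mapE !id_lfunE.
Qed.

Lemma dual_mapM (U V W : vectType k) (f : 'Hom(V, W)) (g : 'Hom(U, V)) :
  dual_map (f \o g)%VF = (dual_map g \o dual_map f)%VF.
Proof.
by apply/lfunP => xi; apply/lfunP => v; rewrite comp_lfunE !dual_mapE comp_lfunE.
Qed.

Lemma tens_map1 (V W : vectType k) :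
  tens_map \1 \1 = \1%VF :> 'End(tens V W).
Proof. by apply: tens_ext => v w; rewrite tens_mapE !id_lfunE. Qed.

Lemma tens_mapM (U V W U' V' W' : vectType k) (f : 'Hom(V, W))
    (g : 'Hom(U, V)) (f' : 'Hom(V', W')) (g' : 'Hom(U', V')) :
  tens_map (f \o g) (f' \o g') = (tens_map f f' \o tens_map g g')%VF.
Proof.
by apply: tens_ext => v w; rewrite comp_lfunE !tens_mapE !comp_lfunE.
Qed.

Lemma tens_map_linearl (V V' W W' : vectType k) (g : 'Hom(W, W')) :
  linear ((@tens_map k V V' W W')^~ g).
Proof.
move=> a f f'; apply: tens_ext => v w.
by rewrite add_lfunE scale_lfunE !tens_mapE add_lfunE scale_lfunE
   tensorDl tensorZl.
Qed.

Lemma tens_map_linearr (V V' W W' : vectType k) (f : 'Hom(V, V')) :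
  linear (@tens_map k V V' W W' f).
Proof.
move=> a g g'; apply: tens_ext => v w.
by rewrite add_lfunE scale_lfunE !tens_mapE add_lfunE scale_lfunE
   tensorDr tensorZr.
Qed.

End LinearTheory.

Section FG.
Variables (k : fieldType) (H : qtHopfAlgebra k) (om : hopfAut H).
Local Notation S := (@antipode k H).
Local Notation dual V := 'Hom(V, k^o).

(* [(h.p)(x) = p(S(h)x)] and [(p.h)(x) = p(x S^-1(om(h)))]. *)
Definition F_lact (h : H) : 'End(dual H) := dual_map (amull (S h)).
Definition F_ract (h : H) : 'End(dual H) := dual_map (amulr ((S^-1)%VF (om h))).

Fact F_lact_linear : linear F_lact.
Proof.
move=> a x y; rewrite /F_lact -dual_map_linear; congr dual_map.
by apply/lfunP => z; rewrite add_lfunE scale_lfunE !lfunE /= linearP mulrDl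
  scalerAl.
Qed.

Fact F_ract_linear : linear F_ract.
Proof.
move=> a x y; rewrite /F_ract -dual_map_linear; congr dual_map.
by apply/lfunP => z; rewrite add_lfunE scale_lfunE !lfunE /= !linearP mulrDr
  scalerAr.
Qed.

Definition F_lactL : 'Hom(H, 'End(dual H)) := linfun F_lact.
Definition F_ractL : 'Hom(H, 'End(dual H)) := linfun F_ract.

Fact F_lactLE (h : H) : F_lactL h = F_lact h.
Proof. exact: (linfunE F_lact_linear). Qed.
Fact F_ractLE (h : H) : F_ractL h = F_ract h.
Proof. exact: (linfunE F_ract_linear). Qed.

Fact F_lact1 : F_lactL 1 = \1%VF.
Proof.
rewrite F_lactLE /F_lact antipode1 -dual_map1.
by congr dual_map; apply/lfunP => z; rewrite !lfunE /= mul1r.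
Qed.

Fact F_lactM (a b : H) :
  F_lactL (a * b) = (F_lactL a \o F_lactL b)%VF.
Proof.
rewrite !F_lactLE /F_lact -dual_mapM; congr dual_map.
by apply/lfunP => z; rewrite comp_lfunE !lfunE /= antipodeM mulrA.
Qed.

Fact F_ract1 : F_ractL 1 = \1%VF.
Proof.
rewrite F_ractLE /F_ract aut1 antipodeV1 -dual_map1.
by congr dual_map; apply/lfunP => z; rewrite !lfunE /= mulr1.
Qed.

Fact F_ractM (a b : H) :
  F_ractL (a * b) = (F_ractL b \o F_ractL a)%VF.
Proof.
rewrite !F_ractLE /F_ract -dual_mapM; congr dual_map.
by apply/lfunP => z; rewrite comp_lfunE !lfunE /= autM antipodeVM mulrA.
Qed.

Fact F_lactract (a b : H) :
  (F_lactL a \o F_ractL b)%VF =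
  (F_ractL b \o F_lactL a)%VF.
Proof.
rewrite F_lactLE F_ractLE /F_lact /F_ract.
rewrite -!dual_mapM; congr dual_map.
by apply/lfunP => z; rewrite !comp_lfunE !lfunE /= mulrA.
Qed.

Definition F_bimod : bimodule H :=
  Bimodule F_lact1 F_lactM F_ract1 F_ractM F_lactract.

(* [h.(xi ⊗ y) = xi(S(om^-1(h)).-) ⊗ y] and [(xi ⊗ y).h = xi ⊗ S^-1(h).y]. *)
Definition G_lact (X Y : module H) (h : H) : 'End(tens (dual X) Y) :=
  tens_map (dual_map (mact (S ((om^-1)%VF h)))) \1.
Definition G_ract (X Y : module H) (h : H) : 'End(tens (dual X) Y) :=
  tens_map \1 (mact ((S^-1)%VF h)).

Definition G_lactL (X Y : module H) : 'Hom(H, 'End(tens (dual X) Y)) :=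
  linfun (@G_lact X Y).
Definition G_ractL (X Y : module H) : 'Hom(H, 'End(tens (dual X) Y)) :=
  linfun (@G_ract X Y).

Section GObj.
Variables X Y : module H.

Fact G_lact_linear : linear (@G_lact X Y).
Proof.
move=> a x y; rewrite /G_lact -tens_map_linearl -dual_map_linear.
by rewrite !linearP.
Qed.

Fact G_ract_linear : linear (@G_ract X Y).
Proof. by move=> a x y; rewrite /G_ract -tens_map_linearr !linearP. Qed.

Fact G_lactLE (h : H) : G_lactL X Y h = G_lact X Y h.
Proof. exact: (linfunE G_lact_linear). Qed.
Fact G_ractLE (h : H) : G_ractL X Y h = G_ract X Y h.
Proof. exact: (linfunE G_ract_linear). Qed.

Fact G_lact1 : G_lactL X Y 1 = \1%VF.
Proof.
by rewrite G_lactLE /G_lact autV1 antipode1 mact1 dual_map1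
  tens_map1.
Qed.

Fact G_lactM (a b : H) : G_lactL X Y (a * b) =
  (G_lactL X Y a \o G_lactL X Y b)%VF.
Proof.
rewrite !G_lactLE /G_lact -tens_mapM -dual_mapM comp_lfun1l.
by rewrite -mactM autVM antipodeM.
Qed.

Fact G_ract1 : G_ractL X Y 1 = \1%VF.
Proof.
by rewrite G_ractLE /G_ract antipodeV1 mact1 tens_map1.
Qed.

Fact G_ractM (a b : H) : G_ractL X Y (a * b) =
  (G_ractL X Y b \o G_ractL X Y a)%VF.
Proof.
rewrite !G_ractLE /G_ract -tens_mapM comp_lfun1l.
by rewrite -mactM antipodeVM.
Qed.

Fact G_lactract (a b : H) :
  (G_lactL X Y a \o G_ractL X Y b)%VF =
  (G_ractL X Y b \o G_lactL X Y a)%VF.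
Proof.
rewrite G_lactLE G_ractLE /G_lact /G_ract.
by rewrite -!tens_mapM !comp_lfun1l !comp_lfun1r.
Qed.

Definition G_obj : bimodule H :=
  Bimodule G_lact1 G_lactM G_ract1 G_ractM G_lactract.

End GObj.

Section GMor.
Variables (X X' Y Y' : module H).
Variables (f : module_hom X' X) (g : module_hom Y Y').

Definition G_lfun : 'Hom(tens (dual X) Y, tens (dual X') Y') :=
  tens_map (dual_map f) g.

Fact G_homl (h : H) (x : G_obj X Y) :
  G_lfun (lact h x) = @lact k H (G_obj X' Y') h (G_lfun x).
Proof.
rewrite /= !G_lactLE /G_lact /G_lfun -!comp_lfunE.
rewrite -!tens_mapM -!dual_mapM comp_lfun1l comp_lfun1r.
congr (tens_map (dual_map _) _ _).
by apply/lfunP => v; rewrite !comp_lfunE module_homP.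
Qed.

Fact G_homr (h : H) (x : G_obj X Y) :
  G_lfun (ract h x) = @ract k H (G_obj X' Y') h (G_lfun x).
Proof.
rewrite /= !G_ractLE /G_ract /G_lfun -!comp_lfunE.
rewrite -!tens_mapM comp_lfun1l comp_lfun1r; congr (tens_map _ _ _).
by apply/lfunP => v; rewrite !comp_lfunE module_homP.
Qed.

Definition G_hom : bimodule_hom (G_obj X Y) (G_obj X' Y') :=
  @BimoduleHom k H (G_obj X Y) (G_obj X' Y') G_lfun G_homl G_homr.

End GMor.

Program Definition G_functor :
    functor (prod_cat (opp_cat (Mod H)) (Mod H)) (Bimod H) :=
  @Functor (prod_cat (opp_cat (Mod H)) (Mod H)) (Bimod H)
    (fun P => G_obj P.1 P.2) (fun P Q fg => G_hom fg.1 fg.2) _ _.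
Next Obligation.
move=> [X Y]; apply: bimodule_hom_eq.
by rewrite /= /G_lfun dual_map1 tens_map1.
Qed.
Next Obligation.
move=> [X Y] [X' Y'] [X'' Y''] [f g] [f' g']; apply: bimodule_hom_eq.
by rewrite /= /G_lfun dual_mapM tens_mapM.
Qed.

(* [xi ⊗ x |-> (h |-> xi(h.x))]. *)
Definition iotaF (X : module H) : 'Hom(tens (dual X) X, dual H) :=
  tens_lift (fun (xi : dual X) (x : X) =>
    linfun (fun h : H => xi (mact h x)) : dual H).

Lemma F_lactE (h : H) (p : F_bimod) (x : H) :
  (lact h p : dual H) x = (p : dual H) (S h * x).
Proof. by rewrite /= F_lactLE dual_mapE lfunE. Qed.

Lemma F_ractE (h : H) (p : F_bimod) (x : H) :
  (ract h p : dual H) x = (p : dual H) (x * (S^-1)%VF (om h)).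
Proof. by rewrite /= F_ractLE dual_mapE lfunE. Qed.

Lemma G_lactE (X Y : module H) (h : H) (xi : dual X) (y : Y) :
  @lact k H (G_obj X Y) h (xi ⊗ y) =
  ((xi \o mact (S ((om^-1)%VF h)))%VF : dual X) ⊗ y.
Proof.
rewrite /= G_lactLE tens_mapE id_lfunE.
by congr (_ ⊗ _); apply/lfunP => x; rewrite dual_mapE comp_lfunE.
Qed.

Lemma G_ractE (X Y : module H) (h : H) (xi : dual X) (y : Y) :
  @ract k H (G_obj X Y) h (xi ⊗ y) = xi ⊗ mact ((S^-1)%VF h) y.
Proof. by rewrite /= G_ractLE tens_mapE id_lfunE. Qed.

Lemma iotaFE (X : module H) (xi : dual X) (x : X) (h : H) :
  iotaF X (xi ⊗ x) h = xi (mact h x).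
Proof.
have fl (xi' : dual X) (y : X) : linear (fun h : H => xi' (mact h y)).
  by move=> a u v; rewrite linearP add_lfunE scale_lfunE linearP.
rewrite /iotaF tens_liftE ?(linfunE (fl _ _)) //.
split=> [f|y] a u v; apply/lfunP => g;
  rewrite add_lfunE scale_lfunE !(linfunE (fl _ _)).
  by rewrite !linearP.
by rewrite add_lfunE scale_lfunE.
Qed.

End FG.

(* Main.v *)
(* The regular module makes the family onto: [iota_H((p \o om) ⊗ 1) = p], so a
   mediating morphism can only be [kappa p = phi_H((p \o om) ⊗ 1)].  Dinaturality
   along the orbit map [h |-> h.x] from the regular module to [X] gives
   [kappa (iota_X t) = phi_X t]; taking [X] to be the regular module, surjectivity
   of [iota_H] carries bilinearity over [H] from [iota_H] and [phi_H] to [kappa]. *)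

Require Import Defs.
From HB Require Import structures.
From mathcomp Require Import all_boot all_algebra all_field.

Set Implicit Arguments.
Unset Strict Implicit.
Unset Printing Implicit Defensive.

Import GRing.Theory.
Local Open Scope ring_scope.

Local Notation dual V := 'Hom(V, _^o).

Section RegularModule.
Variables (k : fieldType) (H : falgType k).

Fact amull_linear : linear (@amull k H).
Proof. by move=> a x y; rewrite linearP. Qed.

Fact amull_lfunE (h : H) : (linfun (@amull k H)) h = amull h.
Proof. exact: (linfunE amull_linear). Qed.

Fact regular_act1 : linfun (@amull k H) 1 = \1%VF.
Proof. by rewrite amull_lfunE amull1. Qed.

Fact regular_actM (a b : H) : linfun (@amull k H) (a * b) =
  (linfun (@amull k H) a \o linfun (@amull k H) b)%VF.
Proof.
by rewrite !amull_lfunE; apply/lfunP => x; rewrite comp_lfunE !lfunE /= mulrA.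
Qed.

Definition regular_module : module H := Module regular_act1 regular_actM.

Lemma regular_actE (h : H) (x : regular_module) : mact h x = h * (x : H).
Proof. by rewrite /= amull_lfunE lfunE. Qed.

Variables (X : module H) (x : X).

Fact orbit_linear : linear (fun h : H => mact h x).
Proof. by move=> a u v; rewrite linearP add_lfunE scale_lfunE. Qed.

Definition orbit_lfun : 'Hom(H, X) := linfun (fun h : H => mact h x).

Lemma orbit_lfunE (h : H) : orbit_lfun h = mact h x.
Proof. exact: (linfunE orbit_linear). Qed.

Fact orbit_homP (h : H) (y : regular_module) :
  orbit_lfun (mact h y) = mact h (orbit_lfun y).
Proof. by rewrite regular_actE !orbit_lfunE mactM comp_lfunE. Qed.

Definition orbit_hom : module_hom regular_module X :=
  @ModuleHom k H regular_module X orbit_lfun orbit_homP.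

End RegularModule.

Section Coend.
Variables (k : fieldType) (H : qtHopfAlgebra k) (om : hopfAut H).
Local Notation S := (@antipode k H).

Lemma autV_antipode (h : H) : (om^-1)%VF (S h) = S ((om^-1)%VF h).
Proof. by apply: (bij_inj (aut_bij om)); rewrite -aut_antipode !autVK. Qed.

(** Follows from the commutation of [om^-1] with [S] after applying [S] to both sides, since the
    antipode is injective. *)
Lemma autV_antipodeV (h : H) :
  (om^-1)%VF ((S^-1)%VF h) = (S^-1)%VF ((om^-1)%VF h).
Proof.
by apply: (@antipode_inj _ H); rewrite -autV_antipode !antipodeVK.
Qed.

Definition twisted_iota (X : module H) : 'Hom(tens (dual X) X, dual H) :=
  (dual_map (om^-1)%VF \o iotaF X)%VF.

Lemma twisted_iotaE (X : module H) (xi : dual X) (x : X) (h : H) :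
  twisted_iota X (xi ⊗ x) h = xi (mact ((om^-1)%VF h) x).
Proof. by rewrite comp_lfunE dual_mapE iotaFE. Qed.

(** On [xi ⊗ x] at [g], both sides equal [xi] of [S(om^-1 h) om^-1(g)] acting on [x]: the twist in
    [G_lact] is the one that [om^-1] produces from [S h]. *)
Fact twisted_iota_homl (X : module H) (h : H) (t : G_obj om X X) :
  twisted_iota X (lact h t) = @lact k H (F_bimod om) h (twisted_iota X t).
Proof.
rewrite -!comp_lfunE; congr (fun_of_lfun _ t); apply: tens_ext => xi x.
rewrite [LHS]comp_lfunE [RHS]comp_lfunE G_lactE; apply/lfunP => g.
rewrite F_lactE !twisted_iotaE comp_lfunE.
by rewrite autVM autV_antipode mactM comp_lfunE.
Qed.

(** Here the [om] in [F_ract] is cancelled by the [om^-1] in [twisted_iota], which leaves the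
    untwisted [S^-1(h)] of [G_ract]. *)
Fact twisted_iota_homr (X : module H) (h : H) (t : G_obj om X X) :
  twisted_iota X (ract h t) = @ract k H (F_bimod om) h (twisted_iota X t).
Proof.
rewrite -!comp_lfunE; congr (fun_of_lfun _ t); apply: tens_ext => xi x.
rewrite [LHS]comp_lfunE [RHS]comp_lfunE G_ractE; apply/lfunP => g.
by rewrite F_ractE !twisted_iotaE autVM autV_antipodeV autK mactM comp_lfunE.
Qed.

Definition twisted_iota_hom (X : module H) :
    bimodule_hom (G_obj om X X) (F_bimod om) :=
  @BimoduleHom k H (G_obj om X X) (F_bimod om) (twisted_iota X)
    (@twisted_iota_homl X) (@twisted_iota_homr X).

(** Linear maps on a tensor product agree once they agree on pure tensors, so dinaturality amounts
    to moving [f] across the tensor sign. *)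
Lemma dinaturalP (B : bimodule H)
    (phi : forall X : module H, bimodule_hom (G_obj om X X) B) :
  @dinatural _ _ (G_functor om) B phi <->
  forall (X Y : module H) (f : module_hom X Y) (xi : dual Y) (x : X),
    phi Y (xi ⊗ f x) = phi X (dual_map f xi ⊗ x).
Proof.
split=> [dn X Y f xi x|dn X Y f].
  have := congr1 (fun g : bimodule_hom (G_obj om Y X) B =>
    bimodule_lfun g (xi ⊗ x)) (dn X Y f).
  by rewrite /= !comp_lfunE /= /G_lfun !tens_mapE /= dual_map1 !id_lfunE.
apply: bimodule_hom_eq; apply: tens_ext => xi x.
by rewrite /= !comp_lfunE /= /G_lfun !tens_mapE /= dual_map1 !id_lfunE dn.
Qed.

Lemma twisted_iota_dinatural :
  @dinatural _ _ (G_functor om) (F_bimod om) twisted_iota_hom.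
Proof.
apply/dinaturalP => X Y f xi x; apply/lfunP => h.
by rewrite !twisted_iotaE dual_mapE module_homP.
Qed.

Let HH := regular_module H.

Definition iota_section_fun (p : dual H) : tens (dual HH) HH :=
  dual_map om p ⊗ (1 : H).

Fact iota_section_linear : linear iota_section_fun.
Proof.
by move=> a p q; rewrite /iota_section_fun linearP tensorDl tensorZl.
Qed.

Definition iota_section : 'Hom(dual H, tens (dual HH) HH) :=
  linfun iota_section_fun.

Lemma iota_sectionE (p : dual H) : iota_section p = dual_map om p ⊗ (1 : H).
Proof. exact: (linfunE iota_section_linear). Qed.

Lemma iota_sectionK : cancel iota_section (twisted_iota HH).
Proof.
move=> p; apply/lfunP => h.
by rewrite iota_sectionE twisted_iotaE regular_actE mulr1 dual_mapE autVK.
Qed.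

Section Mediator.
Variables (B : bimodule H) (phi : forall X : module H,
  bimodule_hom (G_obj om X X) B).
Hypothesis phi_dinat : @dinatural _ _ (G_functor om) B phi.

Definition mediator : 'Hom(dual H, B) := (phi HH \o iota_section)%VF.

Lemma mediator_iota (X : module H) (t : G_obj om X X) :
  mediator (twisted_iota X t) = phi X t.
Proof.
rewrite -comp_lfunE; congr (fun_of_lfun _ t); apply: tens_ext => xi x.
(* Since [x] is the image of [1] under [orbit_hom x], dinaturality moves [xi ⊗ x] to the regular
   module, with second factor [1] as in [iota_section]. *)
have /dinaturalP/(_ _ _ (orbit_hom x) xi (1 : H)) := phi_dinat.
rewrite /= orbit_lfunE mact1 id_lfunE => ->; rewrite [LHS]comp_lfunE.
rewrite [LHS]comp_lfunE iota_sectionE.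
(* The remaining functionals both send [h] to [xi(h.x)], the twists by [om] and [om^-1]
   cancelling. *)
congr (bimodule_lfun (phi HH) _); congr tensor; apply/lfunP => h.
by rewrite !dual_mapE twisted_iotaE autK orbit_lfunE.
Qed.

(** With [p] written as a value of [twisted_iota HH], the action passes inside that morphism, and
    [mediator_iota] reduces the claim to linearity of [phi HH] over [H]. *)
Fact mediator_homl (h : H) (p : F_bimod om) :
  mediator (lact h p) = lact h (mediator p).
Proof.
by rewrite -(iota_sectionK p) -twisted_iota_homl !mediator_iota bimodule_homl.
Qed.

Fact mediator_homr (h : H) (p : F_bimod om) :
  mediator (ract h p) = ract h (mediator p).
Proof.
by rewrite -(iota_sectionK p) -twisted_iota_homr !mediator_iota bimodule_homr.
Qed.

Definition mediator_hom : bimodule_hom (F_bimod om) B :=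
  @BimoduleHom k H (F_bimod om) B mediator mediator_homl mediator_homr.

End Mediator.

Theorem twisted_iota_coend :
  @is_coend _ _ (G_functor om) (F_bimod om) twisted_iota_hom.
Proof.
split=> [|B phi phi_dinat]; first exact: twisted_iota_dinatural.
exists (mediator_hom phi_dinat); split=> [X|kappa kappaP].
  by apply: bimodule_hom_eq; apply/lfunP => t; rewrite comp_lfunE mediator_iota.
apply: bimodule_hom_eq; apply/lfunP => p.
(* Both morphisms are prescribed on the image of [twisted_iota HH], which is all of the dual of
   [H]. *)
rewrite -(iota_sectionK p).
transitivity (phi HH (iota_section p)); first exact: mediator_iota.
by rewrite -(kappaP HH) [LHS]comp_lfunE.
Qed.

End Coend.

Theorem proposition6p2 (k : closedFieldType) (char_k0 : [pchar k] =i pred0)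
    (H : ribbonHopfAlgebra k) (factH : factorizable H) (om : hopfAut H) :
  exists iota : forall X : Mod H, mor (G_functor om (X, X)) (F_bimod om),
    (forall X : Mod H,
       bimodule_lfun (iota X) = (dual_map (om^-1)%VF \o iotaF X)%VF) /\
    is_coend iota.
Proof.
by exists (twisted_iota_hom om); split; last exact: twisted_iota_coend.
Qed.
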